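(* Let $f,g\in L_1$. If $f$ takes all its values in $\mathcal{G}(B_1,\dots,B_n)$, then $$\mathcal{F}_o(f*g)=(\mathcal{F}_o f)(\mathcal{F}_o g).$$ If $g$ takes all its values in $\mathcal{G}(B_1,\dots,B_n)$, then $$(f*g)\mathcal{F}_o=(f\mathcal{F}_o)(g\mathcal{F}_o).$$
   Context: $\mathcal{G}_{2n}$ is the real Clifford algebra generated by an orthonormal basis $e_1,\dots,e_n,e'_1,\dots,e'_n$ of $\mathbb{R}^{2n}$, with $v^2=v\cdot v$ for all vectors $v$ (so basis vectors square to $1$ and distinct basis vectors anticommute). The norm is $|A|^2=\sum_I\alpha_I^2$ for $A=\sum_I\alpha_I e_I$ in the standard basis of ordered products of basis vectors. Put $B_i=e_ie'_i$; then $B_i^2=-1$ and $B_iB_j=B_jB_i$. $\mathcal{G}(B_1,\dots,B_n)$ is the (commutative) subalgebra of $\mathcal{G}_{2n}$ generated by $B_1,\dots,B_n$. The measure is $dm(x)=(2\pi)^{-n/2}dx$ on $\mathbb{R}^n$, with $dx$ Lebesgue measure; $L_1$ is the space of functions $f\colon\mathbb{R}^n\to\mathcal{G}_{2n}$ integrable with respect to $m$. With $I(x,y)=\sum_{i=1}^nB_ix_iy_i$ for $x,y\in\mathbb{R}^n$, the left and right Clifford-Fourier transforms are $$(\mathcal{F}_o f)(y)=\int_{\mathbb{R}^n}e^{-I(x,y)}f(x)\,dm(x),\qquad (f\mathcal{F}_o)(y)=\int_{\mathbb{R}^n}f(x)e^{-I(x,y)}\,dm(x).$$ The convolution is defined almost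 everywhere by $(f*g)(y)=\int_{\mathbb{R}^n}f(y-x)g(x)\,dm(x)$. *)

(* Defs.v *)
From HB Require Import structures.
From mathcomp Require Import all_boot all_order all_algebra.
From mathcomp Require Import ring.

Set Implicit Arguments.
Unset Strict Implicit.
Unset Printing Implicit Defensive.

Import Order.TTheory GRing.Theory Num.Theory.

Local Open Scope ring_scope.

(* The Clifford algebra of R^N with v * v = v . v: an element is its family  *)
(* of coordinates on the ordered products e_I of basis vectors, and          *)
(* e_I e_J = (-1)^(number of pairs (i, j) in I x J with j < i) e_(I symd J). *)
(* clifford_basis_prod, clifford_gen_sqr and clifford_gen_anticomm below are *)
(* the usual presentation.                                                   *)

Section symmetric_difference.
Variable T : finType.
Implicit Types I J K : {set T}.

Definition symd I J : {set T} := [set i | (i \in I) (+) (i \in J)].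

Lemma symdA : associative symd.
Proof. by move=> I J K; apply/setP => i; rewrite !inE addbA. Qed.

Lemma symdC : commutative symd.
Proof. by move=> I J; apply/setP => i; rewrite !inE addbC. Qed.

Lemma symd0 I : symd I set0 = I.
Proof. by apply/setP => i; rewrite !inE addbF. Qed.

Lemma sym0d I : symd set0 I = I.
Proof. by rewrite symdC symd0. Qed.

Lemma symdd I : symd I I = set0.
Proof. by apply/setP => i; rewrite !inE addbb. Qed.

Lemma symdK I : involutive (symd I).
Proof. by move=> J; rewrite symdA symdd sym0d. Qed.

Lemma odd_card_symd I J : odd #|symd I J| = odd #|I| (+) odd #|J|.
Proof.
have -> : symd I J = ((I :\: J) :|: (J :\: I))%SET.
  by apply/setP => i; rewrite !inE; case: (i \in I); case: (i \in J).
have disj : ((I :\: J) :&: (J :\: I))%SET = set0.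
  by apply/setP => i; rewrite !inE; case: (i \in I); case: (i \in J).
rewrite cardsU disj cards0 subn0.
rewrite oddD -(cardsID J I) -(cardsID I J) !oddD setIC.
by do 3!case: odd.
Qed.

End symmetric_difference.

Section inversions.
Variable N : nat.
Implicit Types I J K : {set 'I_N}.

Definition inversions I J : {set 'I_N * 'I_N} :=
  [set p | [&& p.1 \in I, p.2 \in J & (p.2 < p.1)%N]].

Lemma odd_inversionsl I J K : odd #|inversions (symd I J) K| =
  odd #|inversions I K| (+) odd #|inversions J K|.
Proof.
rewrite -odd_card_symd; congr (odd #|pred_of_set _|).
apply/setP => p; rewrite !inE.
by do 3![case: (_ \in _)]; case: (_ < _)%N.
Qed.

Lemma odd_inversionsr I J K : odd #|inversions I (symd J K)| =
  odd #|inversions I J| (+) odd #|inversions I K|.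
Proof.
rewrite -odd_card_symd; congr (odd #|pred_of_set _|).
apply/setP => p; rewrite !inE.
by do 3![case: (_ \in _)]; case: (_ < _)%N.
Qed.

End inversions.

Definition clifford (R : comNzRingType) (N : nat) : Type :=
  {ffun {set 'I_N} -> R}.

HB.instance Definition _ R N := 
  GRing.Lmodule.copy (clifford R N) {ffun {set 'I_N} -> R^o}.

Section clifford_ring.
Variables (R : comNzRingType) (N : nat).
Implicit Types (A B C : clifford R N) (I J K : {set 'I_N}).

Definition clifford_one : clifford R N := [ffun I => (I == set0)%:R].

Definition clifford_mul A B : clifford R N :=
  [ffun K => \sum_I \sum_(J | symd I J == K)
               (-1) ^+ #|inversions I J| * (A I * B J)].

Lemma clifford_mulE A B K : clifford_mul A B K =
  \sum_I (-1) ^+ #|inversions I (symd I K)| * (A I * B (symd I K)).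
Proof.
rewrite ffunE; apply: eq_bigr => I _; rewrite (big_pred1 (symd I K))// => J /=.
by apply/eqP/eqP => [<-|->]; rewrite symdK.
Qed.

Fact clifford_mulA : associative clifford_mul.
Proof.
move=> A B C; apply/ffunP => L; apply: esym; rewrite !clifford_mulE.
under [RHS]eq_bigr do rewrite clifford_mulE mulr_sumr mulr_sumr.
under [LHS]eq_bigr do rewrite clifford_mulE mulr_suml mulr_sumr.
rewrite [LHS]exchange_big; apply: eq_bigr => I _ /=.
rewrite (reindex_inj (inv_inj (@symdK _ I))); apply: eq_bigr => J _ /=.
rewrite symdK -symdA.
have -> : symd I (symd J L) = symd J (symd I L).
  by rewrite symdA (symdC I) -symdA.
rewrite -[(-1) ^+ #|inversions (symd I J) _|]signr_odd odd_inversionsl.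
rewrite -[(-1) ^+ #|inversions I (symd I L)|]signr_odd.
have -> : odd #|inversions I (symd I L)| =
    odd #|inversions I J| (+) odd #|inversions I (symd J (symd I L))|.
  by rewrite -odd_inversionsr symdK.
by rewrite !signr_addb !signr_odd; ring.
Qed.

Fact clifford_mul1l : left_id clifford_one clifford_mul.
Proof.
move=> A; apply/ffunP => K; rewrite clifford_mulE (bigD1 set0)//= big1.
  rewrite sym0d ffunE eqxx mul1r addr0 (_ : inversions _ _ = set0).
    by rewrite cards0 mul1r.
  by apply/setP => p; rewrite !inE.
by move=> I /negbTE I0; rewrite ffunE I0 mul0r mulr0.
Qed.

Fact clifford_mul1r : right_id clifford_one clifford_mul.
Proof.
move=> A; apply/ffunP => K; rewrite clifford_mulE (bigD1 K)//= big1.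
  rewrite symdd ffunE eqxx mulr1 addr0 (_ : inversions _ _ = set0).
    by rewrite cards0 mul1r.
  by apply/setP => p; rewrite !inE andbF.
move=> I /negbTE IK; rewrite ffunE (_ : _ == _ = false) ?mulr0//.
by apply/eqP => /(congr1 (symd I)); rewrite symdK symd0 => /esym/eqP; rewrite IK.
Qed.

Fact clifford_mulDl : left_distributive clifford_mul +%R.
Proof.
move=> A B C; apply/ffunP => K; rewrite [RHS]ffunE !clifford_mulE -big_split.
by apply: eq_bigr => I _; rewrite !ffunE mulrDl mulrDr.
Qed.

Fact clifford_mulDr : right_distributive clifford_mul +%R.
Proof.
move=> A B C; apply/ffunP => K; rewrite [RHS]ffunE !clifford_mulE -big_split.
by apply: eq_bigr => I _; rewrite !ffunE !mulrDr.
Qed.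

Fact clifford_one_neq0 : clifford_one != 0.
Proof.
apply/eqP => /ffunP/(_ set0); rewrite !ffunE eqxx => /eqP.
by rewrite oner_eq0.
Qed.

HB.instance Definition _ := GRing.Zmodule_isNzRing.Build (clifford R N)
  clifford_mulA clifford_mul1l clifford_mul1r clifford_mulDl clifford_mulDr
  clifford_one_neq0.

Fact clifford_scaleAl (a : R) A B : a *: (A * B) = (a *: A) * B.
Proof.
apply/ffunP => K; rewrite [LHS]ffunE !clifford_mulE scaler_sumr.
by apply: eq_bigr => I _; rewrite !ffunE /GRing.scale/=; ring.
Qed.

Fact clifford_scaleAr (a : R) A B : a *: (A * B) = A * (a *: B).
Proof.
apply/ffunP => K; rewrite [LHS]ffunE !clifford_mulE scaler_sumr.
by apply: eq_bigr => I _; rewrite !ffunE /GRing.scale/=; ring.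
Qed.

HB.instance Definition _ :=
  GRing.Lmodule_isLalgebra.Build R (clifford R N) clifford_scaleAl.
HB.instance Definition _ :=
  GRing.Lalgebra_isAlgebra.Build R (clifford R N) clifford_scaleAr.

Definition clifford_basis I : clifford R N := [ffun J => (J == I)%:R].

Definition clifford_gen (i : 'I_N) : clifford R N := clifford_basis [set i]%SET.

Lemma clifford_basisM I J : clifford_basis I * clifford_basis J =
  (-1) ^+ #|inversions I J| *: clifford_basis (symd I J).
Proof.
apply/ffunP => K; rewrite clifford_mulE (bigD1 I)//= big1 ?addr0.
  rewrite !ffunE eqxx mul1r /GRing.scale/=.
  have -> : (symd I K == J) = (K == symd I J).
    by apply/eqP/eqP => [<-|->]; rewrite symdK.
  by have [->|] := eqVneq K (symd I J); rewrite ?symdK// !mulr0.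
by move=> L /negbTE LI; rewrite !ffunE LI mul0r mulr0.
Qed.

Lemma clifford_basis_prod I : clifford_basis I = \prod_(i in I) clifford_gen i.
Proof.
rewrite -big_filter; set s := filter _ _.
have -> : I = [set i in s].
  by apply/setP => i; rewrite inE mem_filter mem_index_enum andbT.
have: sorted (relpre val ltn) s.
  apply: sorted_filter; first by move=> j i k; exact: ltn_trans.
  by rewrite -sorted_map /index_enum unlock -enumT val_enum_ord iota_ltn_sorted.
elim: s => [_|i s IHs /=]; first by rewrite big_nil set_nil.
rewrite path_sortedE; last by move=> j k l; exact: ltn_trans.
move=> /andP[/allP is_lt /IHs IH]; rewrite big_cons -IH clifford_basisM.
have -> : inversions [set i] [set j in s] = set0.
  apply/setP => -[j k]; rewrite !inE /=; apply/and3P => -[/eqP-> ks].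
  by apply/negP; rewrite -leqNgt; exact/ltnW/is_lt.
rewrite cards0 scale1r; congr clifford_basis; apply/setP => j; rewrite !inE.
have [->|//] := eqVneq j i; rewrite (_ : i \in s = false)//.
by apply/negbTE/negP => /is_lt; rewrite /= ltnn.
Qed.

Lemma clifford_gen_sqr i : clifford_gen i * clifford_gen i = 1.
Proof.
rewrite clifford_basisM symdd (_ : inversions _ _ = set0).
  by rewrite cards0 scale1r; apply/ffunP => J; rewrite !ffunE.
apply/setP => -[j k]; rewrite !inE /=.
by apply/and3P => -[/eqP-> /eqP->]; rewrite ltnn.
Qed.

Lemma clifford_gen_anticomm i j : i != j ->
  clifford_gen i * clifford_gen j = - (clifford_gen j * clifford_gen i).
Proof.
move=> ij; rewrite !clifford_basisM [symd [set j] _]symdC -scaleNr.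
congr (_ *: _); have inv1 (k l : 'I_N) :
    inversions [set k] [set l] = if (l < k)%N then [set (k, l)] else set0.
  apply/setP => -[a b]; rewrite !inE /=.
  case: ifP => lk; rewrite !inE.
    by rewrite xpair_eqE; case: eqP => //= ->; case: eqP => //= ->.
  by apply/and3P => -[/eqP-> /eqP->]; rewrite lk.
rewrite !inv1; case: (ltngtP i j) ij => [||/val_inj->]; rewrite ?eqxx// => _ _.
  by rewrite cards0 cards1 expr1 opprK.
by rewrite cards0 cards1 expr1.
Qed.

End clifford_ring.

From mathcomp Require Import all_classical all_reals all_analysis.
Import numFieldNormedType.Exports.

Local Open Scope classical_set_scope.

(* The tuple sigma-algebra generated by the coordinates is the Borel one. *)
Notation Rn R n := (n.-tuple (measurableTypeR R)).

Section lebesgue_Rn.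
Variable R : realType.

Definition cons_Rn n (p : Rn R n * measurableTypeR R) : Rn R n.+1 :=
  [tuple of p.2 :: p.1].

Lemma measurable_cons_Rn n : measurable_fun setT (@cons_Rn n).
Proof. by apply: measurable_cons; [exact: measurable_snd|exact: measurable_fst]. Qed.

Section step.
Variables (n : nat) (mu : {measure set (Rn R n) -> \bar R}).

Definition lebesgue_RnS : set (Rn R n.+1) -> \bar R :=
  pushforward (mu \x lebesgue_measure)%E (@cons_Rn n).

Let lebesgue_RnS0 : lebesgue_RnS set0 = 0%E.
Proof. by rewrite /lebesgue_RnS /pushforward preimage_set0 measure0. Qed.

Let lebesgue_RnS_ge0 A : (0 <= lebesgue_RnS A)%E.
Proof. exact: (measure_ge0 (mu \x lebesgue_measure)%E). Qed.

Let lebesgue_RnS_sigma_additive : semi_sigma_additive lebesgue_RnS.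
Proof.
apply: (@measure_semi_sigma_additive _ _ _
  (pushforward (mu \x lebesgue_measure)%E (@cons_Rn n))).
exact: measurable_cons_Rn.
Qed.

HB.instance Definition _ := isMeasure.Build _ _ _ lebesgue_RnS
  lebesgue_RnS0 lebesgue_RnS_ge0 lebesgue_RnS_sigma_additive.

End step.

Fixpoint lebesgue_Rn n : {measure set (Rn R n) -> \bar R} :=
  match n with
  | 0 => dirac [tuple]
  | n'.+1 => lebesgue_RnS (lebesgue_Rn n')
  end.

Lemma lebesgue_Rn_box n (A : 'I_n -> set (measurableTypeR R)) :
  (forall i, measurable (A i)) ->
  lebesgue_Rn n [set x | forall i, A i (tnth x i)] =
  (\prod_(i < n) lebesgue_measure (A i))%E.
Proof.
elim: n A => [|n IHn] A mA /=.
  rewrite big_ord0 diracE mem_set// => -[[]]//.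
pose A' i := A (lift ord0 i).
have mA' : measurable [set x : Rn R n | forall i, A' i (tnth x i)].
  rewrite (_ : [set _ | _] = \bigcap_(i in setT) ((@tnth n _)^~ i @^-1` A' i)).
    apply: fin_bigcap_measurable => //= i _; rewrite -[X in measurable X]setTI.
    by apply: measurable_tnth => //; exact: mA.
  by apply/seteqP; split => x /= Ax i => [_|]; exact: Ax.
rewrite /lebesgue_RnS /pushforward.
rewrite (_ : _ @^-1` _ = [set x | forall i, A' i (tnth x i)] `*` A ord0).
  by rewrite product_measure1E//= (IHn A') ?big_ord_recl 1?muleC// => i; exact: mA.
have tnthS' x t i : tnth (@cons_Rn n (x, t)) (lift ord0 i) = tnth x i.
  by rewrite !(tnth_nth t).
apply/seteqP; split => -[x t] /=.
  move=> Ax; split; last by have := Ax ord0; rewrite (tnth_nth t).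
  by move=> i; have := Ax (lift ord0 i); rewrite tnthS'.
move=> [Ax At] i; case: (unliftP ord0 i) => [j ->|->]; last first.
  by rewrite (tnth_nth t).
by rewrite tnthS'; exact: Ax.
Qed.

End lebesgue_Rn.

Definition sub_Rn (R : realType) n (x y : Rn R n) : Rn R n :=
  [tuple (tnth x i : R) - tnth y i | i < n].

Section clifford_fourier.
Variables (R : realType) (n : nat).

(* The first n generators are the e_i, the last n the e'_i. *)
Definition G2n : algType R := clifford R (n + n).

Definition bivector (i : 'I_n) : G2n :=
  clifford_gen R (lshift n i) * clifford_gen R (rshift n i).

Definition bivector_algebra : set G2n :=
  smallest (fun S : set G2n => GRing.subalg_closed [in S]) (range bivector).

Definition clifford_norm (A : G2n) : R := Num.sqrt (\sum_I (A I : R) ^+ 2).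

(* The exponential series; norm convergence is coordinatewise convergence. *)
Definition clifford_exp (A : G2n) : G2n :=
  [ffun I => limn (series (fun k => ((k`!%:R)^-1 *: A ^+ k) I : R))].

Definition fourier_measure : {measure set (Rn R n) -> \bar R} :=
  mscale (NngNum (powR_ge0 (2 * pi) (- n%:R / 2))) (lebesgue_Rn R n).

Local Notation m := fourier_measure.

(* The representative h makes every Lebesgue measurable f eligible, although *)
(* measurable sets are Borel here.                                           *)
Definition L1 (f : Rn R n -> G2n) : Prop :=
  exists h : Rn R n -> G2n,
    [/\ {ae m, forall x, f x = h x},
        forall I, measurable_fun setT (fun x => h x I : R) &
        (\int[m]_x (clifford_norm (h x))%:E < +oo)%E].

Definition clifford_integral (f : Rn R n -> G2n) : G2n :=
  [ffun I => \int[m]_x (f x I : R)].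

Definition fourier_form (x y : Rn R n) : G2n :=
  \sum_(i < n) ((tnth x i : R) * tnth y i) *: bivector i.

Definition left_fourier (f : Rn R n -> G2n) (y : Rn R n) : G2n :=
  clifford_integral (fun x => clifford_exp (- fourier_form x y) * f x).

Definition right_fourier (f : Rn R n -> G2n) (y : Rn R n) : G2n :=
  clifford_integral (fun x => f x * clifford_exp (- fourier_form x y)).

(* Meaningful for almost every y when f and g are in L1; where a coordinate  *)
(* is not integrable, the value given by \int is irrelevant.                 *)
Definition convolution (f g : Rn R n -> G2n) (y : Rn R n) : G2n :=
  clifford_integral (fun x => f (sub_Rn y x) * g x).

End clifford_fourier.

(* Main.v *)
From HB Require Import structures.
Require Import Defs.
From mathcomp Require Import all_boot all_order all_algebra.
From mathcomp Require Import ring lra.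
From mathcomp Require Import all_classical all_reals all_analysis.
From mathcomp Require Import measurable_realfun.

(** Write E(x) for the kernel e^{-I(x,z)}, with z fixed. The bivectors B_i
    commute with each other, so the exponential turns sums of their multiples
    into products ([clifford_expD]), and E(x) = E(x - y) E(y)
    ([fourier_kernelD]). If f takes its values in the algebra generated by the
    B_i, then E(y) commutes with f(x - y) ([comm_fourier_kernel]), whence
    <<
      E(x) f(x - y) g(y) = (E(x - y) f(x - y)) (E(y) g(y)),
    >>
    that is, E (f * g) = (E f) * (E g). Since B_i^2 = -1, the kernel is a
    product of rotations cos - B_i sin ([fourier_kernelE]); it is therefore
    measurable and bounded, and E f and E g are again integrable. What is left
    is that the integral of a convolution is the product of the integrals
    ([clifford_integral_convolution]), a coordinatewise consequence of Fubini's
    theorem and of the invariance of the measure under translations. On the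
    right, it is g(y) that has to commute with E(x - y).

    Elements of L_1 are equal almost everywhere to measurable functions, but
    need not be measurable; likewise, f * g has meaningful values only outside
    a null set. Both are harmless, because the integral is defined through the
    simple functions lying below a function and so depends only on its values
    almost everywhere, even without measurability ([integral_ae]). In the
    convolution this uses that reflections x |-> y - x preserve null sets. *)

Set Implicit Arguments.
Unset Strict Implicit.
Unset Printing Implicit Defensive.
Import Order.TTheory GRing.Theory Num.Theory.
Import numFieldNormedType.Exports.
Local Open Scope classical_set_scope.
Local Open Scope ring_scope.

(** * The exponential of commuting elements *)

Section truncated_exponential.
Variables (K : numFieldType) (V : algType K).
Implicit Types A B : V.

Definition expsum A N : V := \sum_(0 <= k < N) (k`!%:R)^-1 *: A ^+ k.

(** The terms of total degree at least [N] in the product of the two truncated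
    exponential series. *)
Definition exptail A B N : V :=
  \sum_(0 <= i < N) \sum_(0 <= j < N | (N - i <= j)%N)
    ((i`!%:R)^-1 * (j`!%:R)^-1) *: (A ^+ i * B ^+ j).

(** By the binomial formula, the terms of total degree below [N] in the product
    make up the truncated exponential of the sum. The algebra is arbitrary so
    that the identity also covers the real numbers, which provide the majorant
    of the remainder. *)
Lemma expsumM A B N : GRing.comm A B ->
  expsum A N * expsum B N = expsum (A + B) N + exptail A B N.
Proof.
move=> AB; pose t i j : V := ((i`!%:R)^-1 * (j`!%:R)^-1) *: (A ^+ i * B ^+ j).
have -> : expsum A N * expsum B N = \sum_(0 <= i < N) \sum_(0 <= j < N) t i j.
  rewrite /expsum mulr_suml; apply: eq_bigr => i _.
  rewrite mulr_sumr; apply: eq_bigr => j _.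
  by rewrite -scalerAl -scalerAr scalerA.
have -> : expsum (A + B) N =
    \sum_(0 <= i < N) \sum_(0 <= j < N | (j < N - i)%N) t i j.
  transitivity (\sum_(0 <= k < N) \sum_(0 <= i < N | (i < k.+1)%N) t i (k - i)%N).
    apply: eq_big_nat => k /andP[_ kN].
    rewrite -(@big_nat_widen _ _ _ 0 k.+1 N xpredT)// addrC exprDn_comm; last exact/commr_sym.
    rewrite big_mkord scaler_sumr; apply: eq_bigr => i _.
    have ik : (i <= k)%N by rewrite -ltnS.
    have -> : B ^+ (k - i) * A ^+ i = A ^+ i * B ^+ (k - i).
      by apply/commrX/commr_sym/commrX.
    rewrite -[_ *+ 'C(_, _)]scaler_nat scalerA; congr (_ *: _).
    have F0 j : j`!%:R != 0 :> K by rewrite pnatr_eq0 -lt0n fact_gt0.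
    have := congr1 (GRing.natmul (1 : K)) (bin_fact ik).
    rewrite !natrM => <-; field; rewrite !F0 /=.
    by rewrite pnatr_eq0 -lt0n bin_gt0.
  rewrite (@exchange_big_dep_nat _ _ _ _ _ _ _ _ _ xpredT)//=.
  apply: eq_big_nat => i /andP[_ iN].
  rewrite -(@big_nat_widenl _ _ _ i 0 N xpredT)// -{1}[i]add0n big_addn.
  rewrite (@big_nat_widen _ _ _ 0 (N - i) N xpredT) ?leq_subr//.
  by apply: eq_bigr => j _; rewrite addnK.
rewrite /exptail -big_split; apply: eq_bigr => i _ /=.
rewrite (bigID (fun j => (j < N - i)%N))/=; congr (_ + _).
by apply: eq_bigl => j; rewrite -leqNgt.
Qed.

End truncated_exponential.

Section l1_norm.
Variables (R : realType) (N : nat).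
Implicit Types A B : clifford R N.

(** Unlike the Euclidean norm, this one is submultiplicative. *)
Definition l1norm A : R := \sum_I `|A I|.

Lemma cliffordME A B K : (A * B) K =
  \sum_I (-1) ^+ #|inversions I (symd I K)| * (A I * B (symd I K)).
Proof. exact: clifford_mulE. Qed.

Lemma l1norm_ge0 A : 0 <= l1norm A.
Proof. by rewrite sumr_ge0. Qed.

Lemma coord_le_l1norm A I : `|A I| <= l1norm A.
Proof. by rewrite /l1norm (bigD1 I)//= lerDl sumr_ge0. Qed.

Lemma l1normD A B : l1norm (A + B) <= l1norm A + l1norm B.
Proof.
by rewrite /l1norm -big_split ler_sum// => I _; rewrite ffunE ler_normD.
Qed.

Lemma l1normZ c A : l1norm (c *: A) = `|c| * l1norm A.
Proof.
by rewrite /l1norm mulr_sumr; apply: eq_bigr => I _; rewrite ffunE normrM.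
Qed.

Lemma l1norm1 : l1norm 1 = 1.
Proof.
rewrite /l1norm (bigD1 (finset.set0 : {set _}))//= big1 ?addr0.
  by rewrite ffunE eqxx normr1.
by move=> I /negbTE I0; rewrite ffunE I0 normr0.
Qed.

Lemma l1normM A B : l1norm (A * B) <= l1norm A * l1norm B.
Proof.
have -> : l1norm A * l1norm B = \sum_K \sum_I `|A I| * `|B (symd I K)|.
  rewrite exchange_big /l1norm mulr_suml; apply: eq_bigr => I _ /=.
  by rewrite mulr_sumr (reindex_inj (inv_inj (@symdK _ I))).
apply: ler_sum => K _; rewrite cliffordME (le_trans (ler_norm_sum _ _ _))//.
by apply: ler_sum => I _; rewrite !normrM normrX normrN1 expr1n mul1r.
Qed.

Lemma l1normX A k : l1norm (A ^+ k) <= l1norm A ^+ k.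
Proof.
elim: k => [|k IHk]; first by rewrite !expr0 l1norm1.
by rewrite !exprS (le_trans (l1normM _ _))// ler_wpM2l// l1norm_ge0.
Qed.

Lemma l1norm_sum (I : Type) (s : seq I) (P : pred I) (F : I -> clifford R N) :
  l1norm (\sum_(i <- s | P i) F i) <= \sum_(i <- s | P i) l1norm (F i).
Proof.
elim/big_rec2: _ => [|i x y _ yx].
  by rewrite /l1norm big1// => I0 _; rewrite ffunE normr0.
by rewrite (le_trans (l1normD _ _))// lerD2l.
Qed.

Lemma l1norm_exptail A B k :
  l1norm (exptail A B k) <= exptail (l1norm A : R^o) (l1norm B : R^o) k.
Proof.
rewrite /exptail (le_trans (l1norm_sum _ _ _))// ler_sum// => i _.
rewrite (le_trans (l1norm_sum _ _ _))// ler_sum// => j _.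
have F0 m : 0 <= (m`!%:R)^-1 :> R by rewrite invr_ge0.
rewrite l1normZ ger0_norm ?mulr_ge0// ler_wpM2l ?mulr_ge0//.
rewrite (le_trans (l1normM _ _))// ler_pM ?l1norm_ge0 ?l1normX//.
Qed.

End l1_norm.

Section exponential.
Variables (R : realType) (n : nat).
Local Notation G := (G2n R n).
Implicit Types A B : G.

Lemma expsum_coord A I : (fun k => expsum A k I) =
  series (fun k => ((k`!%:R)^-1 *: A ^+ k) I : R).
Proof.
by apply/funext => k; rewrite /expsum /series /= sum_ffunE.
Qed.

(** The coordinates of the series are dominated by the real exponential series
    of the norm. *)
Lemma expsum_cvg A I : expsum A k I @[k --> \oo] --> clifford_exp A I.
Proof.
rewrite expsum_coord ffunE.
have : cvgn (series (fun k => ((k`!%:R)^-1 *: A ^+ k) I : R)); last by [].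
apply: normed_cvg; apply: series_le_cvg (is_cvg_series_exp_coeff (l1norm A)).
- by move=> k; rewrite normr_ge0.
- by move=> k; rewrite exp_coeff_ge0// l1norm_ge0.
move=> k /=; rewrite (le_trans (coord_le_l1norm _ _))// l1normZ.
rewrite ger0_norm ?invr_ge0// /exp_coeff /= mulrC ler_wpM2r ?invr_ge0//.
exact: l1normX.
Qed.

Lemma expsum_real (a : R) : expsum (a : R^o) = series (exp_coeff a).
Proof.
apply/funext => k; rewrite /expsum /series /=; apply: eq_bigr => i _.
by rewrite /exp_coeff /= mulrC.
Qed.

(** By the same binomial identity, the tail for real numbers tends to
    e^a e^b - e^(a + b) = 0. *)
Lemma exptail_real_cvg0 (a b : R) :
  exptail (a : R^o) (b : R^o) k @[k --> \oo] --> (0 : R).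
Proof.
have cvge (x : R) : expsum (x : R^o) k @[k --> \oo] --> expR x.
  by rewrite expsum_real; exact: is_cvg_series_exp_coeff.
have -> : (fun k => exptail (a : R^o) (b : R^o) k) =
    (fun k => expsum (a : R^o) k * expsum (b : R^o) k - expsum (a + b : R^o) k).
  apply/funext => k; rewrite (expsumM _ (mulrC _ _ : GRing.comm a b)).
  by rewrite addrC addKr.
by rewrite -[0](subrr (expR (a + b))) {1}expRD; apply: cvgB => //; apply: cvgM.
Qed.

(** The tail is dominated by the real tail of the norms, so the functional
    equation of the real exponential yields that of the Clifford exponential. *)
Lemma exptail_cvg0 A B I : exptail A B k I @[k --> \oo] --> (0 : R).
Proof.
have cvgt := exptail_real_cvg0 (l1norm A) (l1norm B).
apply/norm_cvg0P; apply: (squeeze_cvgr _ (@cvg_cst _ _ _ _ _) cvgt).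
near=> k; rewrite normr_ge0 /=.
by rewrite (le_trans (coord_le_l1norm _ _)) ?l1norm_exptail.
Unshelve. all: by end_near.
Qed.

Lemma clifford_expD A B : GRing.comm A B ->
  clifford_exp (A + B) = clifford_exp A * clifford_exp B.
Proof.
move=> AB; apply/ffunP => K.
have cvgM' : (expsum A k * expsum B k) K @[k --> \oo] -->
    ((clifford_exp A * clifford_exp B) K : R).
  rewrite cliffordME; under eq_fun do rewrite cliffordME.
  apply: cvg_big => [|I _]; first exact: add_continuous.
  by apply: cvgM; [exact: cvg_cst|apply: cvgM; exact: expsum_cvg].
have cvgD' : (expsum A k * expsum B k) K @[k --> \oo] -->
    (clifford_exp (A + B) K + 0 : R).
  under eq_fun do rewrite (expsumM _ AB) ffunE.
  by apply: cvgD; [exact: expsum_cvg|exact: exptail_cvg0].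
by rewrite -[LHS]addr0; exact: (cvg_unique _ cvgD' cvgM').
Qed.

Lemma clifford_exp0 : clifford_exp (0 : G) = 1.
Proof.
have e0 k : expsum (0 : G) k.+1 = 1.
  rewrite /expsum big_nat_recl// expr0 fact0 invr1 scale1r big1 ?addr0//.
  by move=> i _; rewrite expr0n scaler0.
apply/ffunP => I; apply: (cvg_unique (@norm_hausdorff _ _) (@expsum_cvg 0 I)).
apply: cvg_near_cst; near=> k.
have k0 : (0 < k)%N by near: k; exact: nbhs_infty_gt.
by rewrite -(prednK k0) e0.
Unshelve. all: by end_near.
Qed.

Lemma clifford_exp_sum (I : Type) (s : seq I) (F : I -> G) :
  (forall i j, GRing.comm (F i) (F j)) ->
  clifford_exp (\sum_(i <- s) F i) = \prod_(i <- s) clifford_exp (F i).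
Proof.
move=> FF; elim: s => [|i s IHs]; first by rewrite !big_nil clifford_exp0.
by rewrite !big_cons clifford_expD ?IHs//; apply: commr_sum.
Qed.

(** The even powers of B are signs and the odd ones are signed copies of B, so
    the exponential series splits into those of cosine and sine. *)
Lemma clifford_exp_rotation (t : R) B : B * B = -1 ->
  clifford_exp (t *: B) = (cos t)%:A + sin t *: B.
Proof.
move=> BB.
have signA m : (-1) ^+ m = (-1) ^+ m *: 1 :> G.
  rewrite -signr_odd -[(-1) ^+ m in RHS]signr_odd.
  by case: odd; rewrite ?expr0 ?expr1 ?scale1r ?scaleN1r.
have BX k : B ^+ k =
    ((~~ odd k)%:R * (-1) ^+ k./2) *: 1 + ((odd k)%:R * (-1) ^+ k.-1./2) *: B.
  have B2X m : B ^+ m.*2 = (-1) ^+ m by rewrite -mul2n exprM expr2 BB.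
  have := odd_double_half k; case: (odd k) => <-; rewrite ?add0n ?add1n/=.
    by rewrite exprS B2X signA !mul0r mul1r scale0r add0r doubleK -scalerAr mulr1.
  by rewrite B2X signA mul0r mul1r scale0r addr0 doubleK.
apply/ffunP => I; apply: (cvg_unique (@norm_hausdorff _ _) (@expsum_cvg (t *: B) I)) => //.
have -> : (fun k => expsum (t *: B) k I : R) = (fun k =>
    series (cos_coeff t) k * (1 : G) I + series (sin_coeff t) k * B I).
  rewrite expsum_coord; apply/funext => k; rewrite /series /=.
  rewrite !mulr_suml -big_split; apply: eq_bigr => i _ /=.
  rewrite exprZn BX !ffunE /cos_coeff /sin_coeff /= /GRing.scale /=.
  by rewrite -exprnP; ring.
rewrite !ffunE; apply: cvgD; apply: cvgM; do ?exact: cvg_cst.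
  by rewrite cos.unlock; exact: is_cvg_series_cos_coeff.
by rewrite sin.unlock; exact: is_cvg_series_sin_coeff.
Qed.

End exponential.

(** * The bivectors and the Fourier kernel *)

Section bivectors.
Variables (R : realType) (n : nat).
Local Notation G := (G2n R n).
Local Notation B := (bivector R).

Lemma comm_anticomm2 (a b c : G) :
  a * c = - (c * a) -> b * c = - (c * b) -> GRing.comm c (a * b).
Proof.
by move=> ac bc; rewrite /GRing.comm -mulrA bc mulrN mulrA [in RHS]mulrA ac mulNr opprK.
Qed.

Lemma bivector_comm (i j : 'I_n) : GRing.comm (B i) (B j).
Proof.
have [->//|ij] := eqVneq i j.
by apply/commr_sym; apply: commrM; apply/commr_sym; apply: comm_anticomm2;
  apply: clifford_gen_anticomm;
  rewrite ?eq_lshift ?eq_rshift ?eq_lrshift ?eq_rlshift// eq_sym.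
Qed.

Lemma bivector_sqr (i : 'I_n) : B i * B i = -1.
Proof.
have ab : clifford_gen R (rshift n i) * clifford_gen R (lshift n i) =
    - (clifford_gen R (lshift n i) * clifford_gen R (rshift n i)).
  by apply: clifford_gen_anticomm; rewrite eq_rlshift.
rewrite /bivector -mulrA [X in _ * X]mulrA ab mulNr mulrN -mulrA.
by rewrite clifford_gen_sqr mulr1 clifford_gen_sqr.
Qed.

(** The elements commuting with [E] form a subalgebra. *)
Lemma comm_bivector_algebra (E A : G) : (forall i, GRing.comm E (B i)) ->
  bivector_algebra A -> GRing.comm E A.
Proof.
move=> EB /(_ [set C | GRing.comm E C]); apply; split; last first.
  by move=> _ [i _ <-]; exact: EB.
split=> [|c C D|C D]; rewrite !inE /=; first exact: commr1.
  move=> EC ED; apply: commrD => //.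
  by rewrite /GRing.comm -scalerAr -scalerAl EC.
exact: commrM.
Qed.

Lemma fourier_formD (x y z : Rn R n) :
  fourier_form x z = fourier_form (sub_Rn x y) z + fourier_form y z.
Proof.
rewrite /fourier_form -big_split; apply: eq_bigr => i _ /=.
by rewrite tnth_mktuple -scalerDl -mulrDl subrK.
Qed.

Lemma comm_fourier_form_bivector (x y : Rn R n) i :
  GRing.comm (B i) (fourier_form x y).
Proof.
apply: commr_sum => j _.
by rewrite /GRing.comm -scalerAr -scalerAl bivector_comm.
Qed.

Lemma comm_fourier_form (x y z t : Rn R n) :
  GRing.comm (fourier_form x z) (fourier_form y t).
Proof.
apply/commr_sym/commr_sum => i _.
rewrite /GRing.comm -scalerAr -scalerAl; congr (_ *: _).
exact/commr_sym/comm_fourier_form_bivector.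
Qed.

Definition fourier_kernel (z x : Rn R n) : G := clifford_exp (- fourier_form x z).

(** The closed form from which the measurability and the boundedness of the
    kernel are read off. *)
Lemma fourier_kernelE z x : fourier_kernel z x =
  \prod_(i < n) ((cos (tnth x i * tnth z i : R))%:A -
                 sin (tnth x i * tnth z i : R) *: B i).
Proof.
rewrite /fourier_kernel /fourier_form -sumrN.
under eq_bigr do rewrite -scaleNr.
rewrite clifford_exp_sum => [|i j]; last first.
  by rewrite /GRing.comm -!scalerAr -!scalerAl bivector_comm scalerA mulrC -scalerA.
apply: eq_bigr => i _; rewrite clifford_exp_rotation ?bivector_sqr//.
by rewrite cosN sinN scaleNr.
Qed.

Lemma fourier_kernelD z x y :
  fourier_kernel z x = fourier_kernel z (sub_Rn x y) * fourier_kernel z y.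
Proof.
rewrite /fourier_kernel (fourier_formD x y) opprD clifford_expD//.
exact/commrN/commr_sym/commrN/comm_fourier_form.
Qed.

Lemma comm_fourier_kernel z x (A : G) : bivector_algebra A ->
  GRing.comm (fourier_kernel z x) A.
Proof.
apply: comm_bivector_algebra => i; apply/commr_sym.
rewrite fourier_kernelE; apply: commr_prod => j _; apply: commrB.
  by rewrite /GRing.comm -scalerAr -scalerAl mulr1 mul1r.
by rewrite /GRing.comm -scalerAr -scalerAl bivector_comm.
Qed.

Lemma measurable_fourier_kernel z I :
  measurable_fun setT (fun x => fourier_kernel z x I : R).
Proof.
under eq_fun do rewrite fourier_kernelE.
elim: (index_enum _) I => [|i s IHs] I.
  by under eq_fun do rewrite big_nil; exact: measurable_cst.
under eq_fun do rewrite big_cons cliffordME.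
apply: measurable_sum => J; apply: measurable_funM; first exact: measurable_cst.
apply: measurable_funM; last exact: IHs.
under eq_fun do rewrite !ffunE.
have mxz : measurable_fun setT (fun x : Rn R n => tnth x i * tnth z i : R).
  apply: measurable_funM; [exact: measurable_tnth|exact: measurable_cst].
apply: measurable_funB; apply: measurable_funM; try exact: measurable_cst.
  exact: (measurableT_comp (continuous_measurable_fun (@continuous_cos R))).
exact: (measurableT_comp (continuous_measurable_fun (@continuous_sin R))).
Qed.

Lemma fourier_kernel_bounded z x I :
  `|fourier_kernel z x I| <= \prod_(i < n) (1 + l1norm (B i)).
Proof.
rewrite (le_trans (coord_le_l1norm _ _))// fourier_kernelE.
elim/big_rec2: _ => [|i M E _ EM]; first by rewrite l1norm1.
rewrite (le_trans (l1normM _ _))// ler_pM ?l1norm_ge0//.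
rewrite (le_trans (l1normD _ _))// -scaleNr !l1normZ l1norm1 mulr1 normrN.
rewrite lerD// ?ler_norml ?cos_geN1 ?cos_le1//.
by rewrite ler_piMl ?l1norm_ge0// ler_norml sin_geN1 sin_le1.
Qed.

End bivectors.

(** * Integrals of functions equal almost everywhere *)

Section integral_ae.
Local Open Scope ereal_scope.
Context d (T : measurableType d) (R : realType).
Variable mu : {measure set T -> \bar R}.
Import HBNNSimple.

(** The integral of a nonnegative function is the supremum of the integrals of
    the simple functions below it. Cutting such a simple function off on a null
    set leaves its integral unchanged, so null sets cannot affect the supremum. *)
Lemma ge0_integral_ae_le (f g : T -> \bar R) :
  (forall x, 0 <= f x) -> (forall x, 0 <= g x) ->
  {ae mu, forall x, f x = g x} -> \int[mu]_x f x <= \int[mu]_x g x.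
Proof.
move=> f0 g0 [N [mN N0 fgN]]; rewrite !ge0_integralTE//.
apply: ge_ereal_sup => /= _ [h hf <-]; apply: ereal_sup_ubound.
have mNC : measurable (~` N) by exact: measurableC.
exists (proj_nnsfun h mNC).
  move=> x /=; rewrite mindicE; have [xN|] := boolP (x \in ~` N); last first.
    by rewrite mulr0.
  rewrite mulr1 (_ : g x = f x)//; apply: contrapT => /= gfx.
  by move: xN; rewrite inE; apply; apply: fgN => /= /esym.
rewrite -!integralT_nnsfun.
rewrite [RHS](ge0_negligible_integral mN)//; last 2 first.
  exact/measurable_EFinP.
  by move=> x _; rewrite lee_fin.
rewrite setTD [RHS]integral_mkcond; apply: eq_integral => x _ /=.
by rewrite mindicE patchE; case: ifP => _; rewrite (mulr1, mulr0).
Qed.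

Lemma integral_ae (f g : T -> \bar R) :
  {ae mu, forall x, f x = g x} -> \int[mu]_x f x = \int[mu]_x g x.
Proof.
have ge0_case u v : (forall x, 0 <= u x) -> (forall x, 0 <= v x) ->
    {ae mu, forall x, u x = v x} -> \int[mu]_x u x = \int[mu]_x v x.
  move=> u0 v0 uv; apply/eqP; rewrite eq_le !ge0_integral_ae_le//.
  by apply: filterS uv => x ->.
move=> fg; rewrite integralE [RHS]integralE; congr (_ - _).
  by apply: ge0_case => //; apply: filterS fg => x; rewrite !funeposE => ->.
by apply: ge0_case => //; apply: filterS fg => x; rewrite !funenegE => ->.
Qed.

End integral_ae.

(** * Reflections and translations of Lebesgue measure *)

Section as_sigma_finite.
Context d (T : measurableType d) (R : realType).
Variables (mu : {measure set T -> \bar R}) (mu_sf : sigma_finite setT mu).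

(** A copy of [mu] that carries the proof of its sigma-finiteness, so that the
    theorems on product measures apply to it. *)
Definition as_sigma_finite of sigma_finite setT mu : set T -> \bar R := mu.

HB.instance Definition _ :=
  Measure.copy (as_sigma_finite mu_sf) (Measure.sort mu).
HB.instance Definition _ :=
  Measure_isSigmaFinite.Build _ _ _ (as_sigma_finite mu_sf) mu_sf.

End as_sigma_finite.

Section reflection.
Variable R : realType.
Local Notation mT := (measurableTypeR R).

Lemma measurable_subr (y : R) : measurable_fun setT (fun x : mT => y - x : mT).
Proof. by apply: measurable_funB. Qed.

(** A reflection exchanges half-open intervals of the two kinds and keeps their
    length; half-open intervals determine Lebesgue measure. *)
Lemma lebesgue_measure_reflection (y : R) (A : set mT) : measurable A ->
  lebesgue_measure ((fun x : mT => y - x) @^-1` A) = lebesgue_measure A.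
Proof.
move=> mA; symmetry.
pose nu := measure_function_pushforward__canonical__measure_function_Measure
  (@lebesgue_measure R) (measurable_subr y).
have nuE : forall X, ocitv X -> lebesgue_measure X = nu X; last first.
  exact: (lebesgue_measure_unique nuE mA).
move=> _ [[a b] _ <-] /=.
rewrite /pushforward (_ : _ @^-1` _ = [set` `[y - b, y - a[]).
  rewrite !lebesgue_measure_itv/= !lte_fin ltrD2l ltrN2.
  by case: ifP => // _; rewrite -!EFinB; congr EFin; ring.
apply/seteqP; split => x /=; rewrite !in_itv/=; lra.
Qed.
End reflection.

Section lebesgue_Rn_invariance.
Variable R : realType.
Local Notation mT := (measurableTypeR R).

(** The cubes with vertices at plus or minus k exhaust the space. *)
Lemma sigma_finite_lebesgue_Rn n : sigma_finite setT (lebesgue_Rn R n).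
Proof.
pose A (k : nat) (i : 'I_n) : set mT := [set` `[- k%:R, (k%:R : R)]].
have mA k i : measurable (A k i) by exact: measurable_itv.
exists (fun k => [set x | forall i, A k i (tnth x i)]).
  apply/esym/seteqP; split => // x _.
  (* Every coordinate is at most the sum of the absolute values of all of them. *)
  exists (Num.truncn (\sum_i `|tnth x i : R|)).+1 => // i.
  rewrite /A /= in_itv /= -ler_norml.
  rewrite (le_trans _ (ltW (truncnS_gt _)))//.
  by rewrite (bigD1 i)//= lerDl sumr_ge0.
move=> k; split.
  rewrite (_ : [set _ | _] = \bigcap_(i in setT) ((@tnth n _)^~ i @^-1` A k i)).
    apply: fin_bigcap_measurable => //= i _; rewrite -[X in measurable X]setTI.
    by apply: measurable_tnth => //; exact: mA.
  by apply/seteqP; split => x /= Ax i => [_|]; exact: Ax.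
rewrite lebesgue_Rn_box//.
suff : (\prod_(i < n) lebesgue_measure (A k i))%E \is a fin_num.
  by rewrite fin_numElt => /andP[].
elim/big_ind: _ => // [x y|i _]; first exact: fin_numM.
by rewrite lebesgue_measure_itv/=; case: ifP => // _; rewrite -EFinB.
Qed.

Lemma measurable_sub_Rn n :
  measurable_fun setT (fun p : Rn R n * Rn R n => sub_Rn p.1 p.2).
Proof.
apply/measurable_fun_tnthP => i.
rewrite (_ : _ \o _ = (fun p => tnth p.1 i - tnth p.2 i : mT)); last first.
  by apply/funext => p /=; rewrite tnth_mktuple.
apply: measurable_funB; apply: (measurableT_comp (measurable_tnth i)) => //.
Qed.

Lemma sub_Rn_cons n (y x : Rn R n) (s t : mT) :
  sub_Rn (cons_Rn (y, s)) (cons_Rn (x, t)) = cons_Rn (sub_Rn y x, s - t).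
Proof.
apply: eq_from_tnth => i; rewrite tnth_mktuple.
case: (unliftP ord0 i) => [j ->|->]; last by rewrite !(tnth_nth 0).
by rewrite !tnthS tnth_mktuple.
Qed.

Lemma cons_Rn_surj n (y : Rn R n.+1) : exists z s, y = cons_Rn (z, s).
Proof. by case/tupleP: y => s z; exists z, s; apply: val_inj. Qed.

Lemma measurable_sub_Rnl n (y : Rn R n) : measurable_fun setT (sub_Rn y).
Proof. exact: (measurableT_comp (@measurable_sub_Rn n) (measurable_pair1 y)). Qed.

(** A reflection of a product is the product of the reflections of its factors,
    hence preserves the measure of rectangles, and these determine the product
    measure. *)
Lemma lebesgue_Rn_reflection n (y : Rn R n) (A : set (Rn R n)) : measurable A ->
  lebesgue_Rn R n (sub_Rn y @^-1` A) = lebesgue_Rn R n A.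
Proof.
elim: n y A => [y A mA|n IHn y A mA].
  congr (lebesgue_Rn R 0 _); apply/seteqP; split => x /=;
  by rewrite (tuple0 x) (tuple0 (sub_Rn _ _)).
have [z [s ->]] := cons_Rn_surj y.
pose phi (p : Rn R n * mT) := (sub_Rn z p.1, s - p.2 : mT).
have mphi : measurable_fun setT phi.
  apply: measurable_fun_pair.
    by apply: (measurableT_comp (measurable_sub_Rnl z)) => //.
  by apply: (measurableT_comp (measurable_subr s)) => //.
pose L : {sigma_finite_measure set (Rn R n) -> \bar R} :=
  as_sigma_finite (sigma_finite_lebesgue_Rn n).
pose nu := measure_function_pushforward__canonical__measure_function_Measure
  (L \x lebesgue_measure)%E mphi.
have nuE : forall B C, measurable B -> measurable C ->
    nu (B `*` C) = (L B * lebesgue_measure C)%E.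
  move=> B C mB mC.
  transitivity ((L \x lebesgue_measure)%E
    ((sub_Rn z @^-1` B) `*` ((fun x => s - x) @^-1` C))) => //.
  rewrite product_measure1E; last 2 first.
  - by rewrite -[X in measurable X]setTI; exact: measurable_sub_Rnl.
  - by rewrite -[X in measurable X]setTI; exact: measurable_subr.
  by congr (_ * _)%E; [exact: IHn|exact: lebesgue_measure_reflection].
have mcA : measurable (@cons_Rn R n @^-1` A).
  by rewrite -[X in measurable X]setTI; exact: measurable_cons_Rn.
have := product_measure_unique nuE mcA.
rewrite /= /lebesgue_RnS /pushforward => ->.
rewrite /nu /= /pushforward; congr (product_measure1 _ _ _).
by apply/seteqP; split => -[x t] /=; rewrite sub_Rn_cons.
Qed.

End lebesgue_Rn_invariance.

Section fourier_measure_invariance.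
Variables (R : realType) (n : nat).
Local Notation m := (fourier_measure R n).

Lemma sigma_finite_fourier_measure : sigma_finite setT m.
Proof.
have [F FT Ffin] := sigma_finite_lebesgue_Rn R n.
exists F => // k; have [mF Flty] := Ffin k; split=> //.
by rewrite /= /mscale /= lte_mul_pinfty// ?lee_fin ?powR_ge0.
Qed.

Lemma fourier_measure_reflection (y : Rn R n) (A : set (Rn R n)) :
  measurable A -> m (sub_Rn y @^-1` A) = m A.
Proof.
by move=> mA; rewrite /= /mscale /= lebesgue_Rn_reflection.
Qed.

(** A translation is the composite of two reflections. *)
Lemma fourier_measure_translation (y : Rn R n) (A : set (Rn R n)) :
  measurable A -> m ((fun x => sub_Rn x y) @^-1` A) = m A.
Proof.
move=> mA; pose o : Rn R n := [tuple 0 | i < n].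
have -> : (fun x => sub_Rn x y) = sub_Rn o \o sub_Rn y.
  apply/funext => x; apply: eq_from_tnth => i.
  by rewrite !tnth_mktuple sub0r opprB.
rewrite comp_preimage !fourier_measure_reflection//.
by rewrite -[X in measurable X]setTI; exact: measurable_sub_Rnl.
Qed.

End fourier_measure_invariance.

(** * The integral of a convolution *)

Section invariant_map.
Local Open Scope ereal_scope.
Context d (T : measurableType d) (R : realType).
Variables (mu : {measure set T -> \bar R}) (phi : T -> T).
Hypothesis mphi : measurable_fun setT phi.
Hypothesis mu_phi : forall A, measurable A -> mu (phi @^-1` A) = mu A.

Lemma ge0_integral_invariant (f : T -> \bar R) : measurable_fun setT f ->
  (forall x, 0 <= f x) -> \int[mu]_x f (phi x) = \int[mu]_x f x.
Proof.
move=> mf f0; have := @ge0_integral_pushforward _ _ _ _ _ _ mphi mu setT f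
  measurableT mf (fun x _ => f0 x).
rewrite preimage_setT => <-.
pose nu := measure_function_pushforward__canonical__measure_function_Measure
  mu mphi.
by apply: (@eq_measure_integral _ _ _ setT mu nu) => A mA _; exact: mu_phi.
Qed.

Lemma integral_invariant (f : T -> \bar R) : measurable_fun setT f ->
  \int[mu]_x f (phi x) = \int[mu]_x f x.
Proof.
move=> mf; rewrite integralE [RHS]integralE; congr (_ - _).
  rewrite -(ge0_integral_invariant (measurable_funepos mf))//.
  by apply: eq_integral => x _; rewrite funepos_comp.
rewrite -(ge0_integral_invariant (measurable_funeneg mf))//.
by apply: eq_integral => x _; rewrite funeneg_comp.
Qed.

Lemma ae_invariant (P : T -> Prop) :
  {ae mu, forall x, P x} -> {ae mu, forall x, P (phi x)}.
Proof.
move=> [N [mN N0 PN]]; exists (phi @^-1` N); split.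
- by rewrite -[X in measurable X]setTI; exact: mphi.
- by rewrite mu_phi.
- by move=> x /= Px; exact: PN.
Qed.

End invariant_map.

Section integrable_fine.
Local Open Scope ereal_scope.
Context d (T : measurableType d) (R : realType).
Variable mu : {measure set T -> \bar R}.

Lemma integrable_EFin_fine (f : T -> \bar R) : mu.-integrable setT f ->
  mu.-integrable setT (fun x => (fine (f x))%:E).
Proof.
move=> fi; apply: (le_integrable measurableT _ _ fi) => //.
  apply/measurable_EFinP; apply: measurableT_comp => //.
  exact: measurable_int fi.
by move=> x _; case: (f x) => [r||] /=; rewrite ?normr0 ?leey ?lexx.
Qed.

(** For the inner integral in Fubini's theorem, which is a real number only for
    almost every value of the outer variable. *)
Lemma integral_EFin_fine (f : T -> \bar R) : mu.-integrable setT f ->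
  \int[mu]_x (fine (f x))%:E = \int[mu]_x f x.
Proof.
move=> fi; apply: integral_ae.
by apply: filterS (integrable_ae measurableT fi) => x /(_ I) /fineK.
Qed.

End integrable_fine.

Section convolution_integral.
Context d (T : measurableType d) (R : realType).
Variables (mu : {measure set T -> \bar R}) (mu_sf : sigma_finite setT mu).
Variable sub : T -> T -> T.
Hypothesis msub : measurable_fun setT (fun p : T * T => sub p.1 p.2).
Hypothesis mu_translation : forall y A, measurable A ->
  mu ((fun x => sub x y) @^-1` A) = mu A.

Variables u v : T -> R.
Hypothesis (ui : mu.-integrable setT (EFin \o u)).
Hypothesis (vi : mu.-integrable setT (EFin \o v)).

Let nu : {sigma_finite_measure set T -> \bar R} := as_sigma_finite mu_sf.

Let K (p : T * T) := (u (sub p.1 p.2) * v p.2)%:E.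

Let mu_fun : measurable_fun setT u.
Proof. by apply/measurable_EFinP; exact: measurable_int ui. Qed.

Let mv_fun : measurable_fun setT v.
Proof. by apply/measurable_EFinP; exact: measurable_int vi. Qed.

Let mK : measurable_fun setT K.
Proof.
apply/measurable_EFinP; apply: measurable_funM.
  exact: (measurableT_comp mu_fun msub).
exact: (measurableT_comp mv_fun measurable_snd).
Qed.

Let msubr y : measurable_fun setT (fun x => sub x y).
Proof. exact: (measurableT_comp msub (measurable_pair2 y)). Qed.

Let KE (x y : T) : K (x, y) = ((v y)%:E * (u (sub x y))%:E)%E.
Proof. by rewrite -EFinM mulrC. Qed.

Let intK y : (\int[mu]_x K (x, y) = (v y)%:E * \int[mu]_x (u x)%:E)%E.
Proof.
under eq_integral do rewrite KE.
have mu' : measurable_fun setT (EFin \o u) by exact: measurable_int ui.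
rewrite -(integral_invariant (msubr y) (mu_translation y) mu').
rewrite integralZl//; apply/integrableP; split.
  exact: (measurableT_comp mu' (msubr y)).
rewrite (ge0_integral_invariant (msubr y) (mu_translation y)
  (measurableT_comp (@abse_measurable _ setT) mu'))//.
  by case/integrableP : ui.
by move=> x; exact: abse_ge0.
Qed.

(* Integrating over x first, with y fixed, translation invariance separates
   the two factors. *)
Let Ki : (nu \x nu)%E.-integrable setT K.
Proof.
apply/(integrable21ltyP _ _ mK).
have muabs : measurable_fun setT (fun x => `|(u x)%:E|)%E.
  by apply: measurableT_comp => //; exact: measurable_int ui.
have -> : (\int[mu]_y \int[mu]_x `|K (x, y)| =
    \int[mu]_y (`|(v y)%:E| * \int[mu]_x `|(u x)%:E|))%E.
  apply: eq_integral => y _; under eq_integral do rewrite KE abseM.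
  rewrite -(ge0_integral_invariant (msubr y) (mu_translation y) muabs)//.
  rewrite ge0_integralZl//; exact: (measurableT_comp muabs (msubr y)).
case/integrableP : ui => _ ulty; case/integrableP : vi => mv vlty.
rewrite ge0_integralZr//; last 2 first.
  exact: measurableT_comp.
  exact: integral_ge0.
by rewrite lte_mul_pinfty ?integral_ge0// ge0_fin_numE ?integral_ge0.
Qed.

Lemma ae_integrable_convolution :
  {ae mu, forall x, mu.-integrable setT (fun y => (u (sub x y) * v y)%:E)}.
Proof. exact: (ae_integrable1 Ki). Qed.

Lemma integrable_convolution :
  mu.-integrable setT (fun x => (\int[mu]_y (u (sub x y) * v y))%:E).
Proof.
exact: (integrable_EFin_fine (integrable_fubini_F Ki)).
Qed.

Lemma Rintegral_convolution :
  \int[mu]_x \int[mu]_y (u (sub x y) * v y) =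
  \int[mu]_x u x * \int[mu]_x v x.
Proof.
rewrite {1}/Rintegral.
rewrite (integral_EFin_fine (integrable_fubini_F Ki)).
rewrite (Fubini (m1 := nu) Ki : (\int[mu]_x \int[mu]_y K (x, y) = _)%E).
under eq_integral do rewrite intK.
have ufin : (\int[mu]_x (u x)%:E)%E \is a fin_num by exact: integrable_fin_num.
rewrite -(fineK ufin) integralZr// fineM//; last exact: integrable_fin_num.
by rewrite mulrC.
Qed.

End convolution_integral.

Section linear_combination.
Context d (T : measurableType d) (R : realType) (I : finType).
Variables (mu : {measure set T -> \bar R}) (c : I -> R) (f : I -> T -> R).
Hypothesis fi : forall i, mu.-integrable setT (fun x => (f i x)%:E).

Let cfi i : mu.-integrable setT (fun x => (c i * f i x)%:E).
Proof. by under eq_fun do rewrite EFinM; exact: integrableZl. Qed.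

Lemma integrable_lincomb :
  mu.-integrable setT (fun x => (\sum_i c i * f i x)%:E).
Proof.
under eq_fun do rewrite -sumEFin.
apply: (integrable_sum measurableT) => i _; exact: cfi.
Qed.

Lemma Rintegral_lincomb :
  \int[mu]_x (\sum_i c i * f i x) = \sum_i c i * \int[mu]_x f i x.
Proof.
rewrite {1}/Rintegral; under eq_integral do rewrite -sumEFin.
rewrite integral_sum// -sum_fine; last by move=> i _; exact: integrable_fin_num.
by apply: eq_bigr => i _; apply: RintegralZl => //; exact: fi.
Qed.

End linear_combination.

Section clifford_integrability.
Variables (R : realType) (n : nat).
Local Notation m := (fourier_measure R n).
Local Notation G := (G2n R n).
Implicit Types (F H : Rn R n -> G) (C : G).

Definition clifford_integrable F :=
  forall I, m.-integrable setT (fun x => (F x I : R)%:E).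

Lemma clifford_integral_ae F H : {ae m, forall x, F x = H x} ->
  clifford_integral F = clifford_integral H.
Proof.
move=> FH; apply/ffunP => I; rewrite !ffunE /Rintegral; congr fine.
by apply: integral_ae; apply: filterS FH => x ->.
Qed.

Lemma clifford_integralMl C F : clifford_integrable F ->
  clifford_integral (fun x => C * F x) = C * clifford_integral F.
Proof.
move=> Fi; apply/ffunP => K; rewrite ffunE cliffordME.
under eq_Rintegral do rewrite cliffordME.
under eq_Rintegral do under eq_bigr do rewrite mulrA.
by rewrite Rintegral_lincomb//; apply: eq_bigr => I _; rewrite ffunE mulrA.
Qed.

Lemma clifford_integralMr C F : clifford_integrable F ->
  clifford_integral (fun x => F x * C) = clifford_integral F * C.
Proof.
move=> Fi; apply/ffunP => K; rewrite ffunE cliffordME.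
under eq_Rintegral do rewrite cliffordME.
under eq_Rintegral do under eq_bigr do rewrite [X in _ * X]mulrC mulrA.
rewrite Rintegral_lincomb//; apply: eq_bigr => I _.
by rewrite ffunE -mulrA [_ * C _]mulrC.
Qed.

(** Each coordinate is bounded by the norm. *)
Lemma L1_representative F : L1 F ->
  exists2 h, {ae m, forall x, F x = h x} & clifford_integrable h.
Proof.
move=> [h [Fh mh hlty]]; exists h => // I.
have mnorm : measurable_fun setT (fun x => clifford_norm (h x)).
  apply: (measurableT_comp (continuous_measurable_fun (@sqrt_continuous R))).
  apply: measurable_sum => J; apply: measurable_funX; exact: mh.
apply/integrableP; split; first by apply/measurable_EFinP; exact: mh.
apply: le_lt_trans hlty; apply: ge0_le_integral => //.
- by apply: measurableT_comp => //; apply/measurable_EFinP; exact: mh.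
- exact/measurable_EFinP.
move=> x _; rewrite abse_EFin lee_fin -sqrtr_sqr ler_sqrt; last first.
  by rewrite sumr_ge0// => J _; exact: sqr_ge0.
by rewrite (bigD1 I)//= lerDl sumr_ge0// => J _; exact: sqr_ge0.
Qed.

Section multiplier.
Variables (E : Rn R n -> G) (M : R).
Hypothesis mE : forall I, measurable_fun setT (fun x => E x I : R).
Hypothesis ME : forall I x, `|E x I| <= M.

Let EFi I J F : clifford_integrable F ->
  m.-integrable setT (fun x => (E x I * F x J)%:E).
Proof.
move=> Fi; have EM : [bounded E x I | x in [set: Rn R n]].
  exists M; split; rewrite ?num_real// => r Mr x _.
  by apply: le_trans (ME I x) _; exact: ltW.
have := integrableMr measurableT (mE I) EM (Fi J).
by apply: eq_integrable => // x _ /=; rewrite EFinM.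
Qed.

Lemma clifford_integrable_multl F : clifford_integrable F ->
  clifford_integrable (fun x => E x * F x).
Proof.
move=> Fi K; under eq_fun do rewrite cliffordME.
by apply: integrable_lincomb => I; exact: EFi.
Qed.

Lemma clifford_integrable_multr F : clifford_integrable F ->
  clifford_integrable (fun x => F x * E x).
Proof.
move=> Fi K; under eq_fun do rewrite cliffordME.
apply: integrable_lincomb => I.
by under eq_fun do rewrite mulrC; exact: EFi.
Qed.

End multiplier.

Section convolution.
Variables F H : Rn R n -> G.
Hypotheses (Fi : clifford_integrable F) (Hi : clifford_integrable H).

Let FHi I J : {ae m, forall x,
  m.-integrable setT (fun y => (F (sub_Rn x y) I * H y J : R)%:E)}.
Proof.
exact: (ae_integrable_convolution (@sigma_finite_fourier_measure R n)
  (@measurable_sub_Rn R n) (@fourier_measure_translation R n) (Fi I) (Hi J)).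
Qed.

Let FHi_all : {ae m, forall x, forall I J,
  m.-integrable setT (fun y => (F (sub_Rn x y) I * H y J : R)%:E)}.
Proof. by do 2![apply: filter_forall => ?]; exact: FHi. Qed.

Lemma ae_clifford_integrable_convolution :
  {ae m, forall x, clifford_integrable (fun y => F (sub_Rn x y) * H y)}.
Proof.
apply: filterS FHi_all => x FHx K; under eq_fun do rewrite cliffordME.
exact: integrable_lincomb.
Qed.

(** Each coordinate of the convolution is, almost everywhere, a signed sum of
    convolutions of coordinates of the two factors. *)
Lemma clifford_integral_convolution :
  clifford_integral (convolution F H) =
  clifford_integral F * clifford_integral H.
Proof.
apply/ffunP => K; rewrite ffunE cliffordME.
pose conv I J x := \int[m]_y (F (sub_Rn x y) I * H y J).
transitivity (\int[m]_x (\sum_I (-1) ^+ #|inversions I (symd I K)| *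
    conv I (symd I K) x)).
  congr fine; apply: integral_ae; apply: filterS FHi_all => x FHx.
  rewrite ffunE; under eq_Rintegral do rewrite cliffordME.
  by rewrite Rintegral_lincomb.
rewrite Rintegral_lincomb => [|I].
  apply: eq_bigr => I _; rewrite !ffunE; congr (_ * _).
  exact: (Rintegral_convolution (@sigma_finite_fourier_measure R n)
    (@measurable_sub_Rn R n) (@fourier_measure_translation R n) (Fi I) (Hi _)).
exact: (integrable_convolution (@sigma_finite_fourier_measure R n)
  (@measurable_sub_Rn R n) (@fourier_measure_translation R n) (Fi I) (Hi _)).
Qed.

End convolution.

End clifford_integrability.

(** * The Fourier transform of a convolution *)

Lemma mulrACA_comm (A : pzRingType) (a b c d : A) : GRing.comm b c ->
  a * b * (c * d) = a * c * (b * d).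
Proof. by move=> bc; rewrite -!mulrA [b * _]mulrA bc !mulrA. Qed.

Section fourier_of_convolution.
Variables (R : realType) (n : nat).
Local Notation m := (fourier_measure R n).
Implicit Types f g h k : Rn R n -> G2n R n.

Lemma left_fourier_ae f h z : {ae m, forall x, f x = h x} ->
  left_fourier f z = left_fourier h z.
Proof.
by move=> fh; apply: clifford_integral_ae; apply: filterS fh => x ->.
Qed.

Lemma right_fourier_ae f h z : {ae m, forall x, f x = h x} ->
  right_fourier f z = right_fourier h z.
Proof.
by move=> fh; apply: clifford_integral_ae; apply: filterS fh => x ->.
Qed.

Lemma ae_sub_Rn (P : Rn R n -> Prop) x : {ae m, forall y, P y} ->
  {ae m, forall y, P (sub_Rn x y)}.
Proof.
exact: (ae_invariant (measurable_sub_Rnl x) (fourier_measure_reflection x)).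
Qed.

(** Equality holds at every point x, since y |-> x - y pulls null sets back to
    null sets. *)
Lemma convolution_ae f g h k : {ae m, forall x, f x = h x} ->
  {ae m, forall x, g x = k x} -> convolution f g = convolution h k.
Proof.
move=> fh gk; apply/funext => x; apply: clifford_integral_ae.
by apply: filterS2 (ae_sub_Rn x fh) gk => y -> ->.
Qed.

Lemma left_fourier_convolution h k z : clifford_integrable h ->
  clifford_integrable k -> {ae m, forall x, bivector_algebra (h x)} ->
  left_fourier (convolution h k) z = left_fourier h z * left_fourier k z.
Proof.
move=> hi ki hB; pose E := fourier_kernel z.
have Ei F : clifford_integrable F -> clifford_integrable (fun x => E x * F x).
  exact: (clifford_integrable_multl (measurable_fourier_kernel z)
    (fun I x => fourier_kernel_bounded z x I)).
rewrite /left_fourier -(clifford_integral_convolution (Ei _ hi) (Ei _ ki)).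
apply: clifford_integral_ae.
apply: filterS (ae_clifford_integrable_convolution hi ki) => x hki.
apply: etrans (esym (clifford_integralMl (E x) hki)) _.
apply: clifford_integral_ae.
apply: filterS (ae_sub_Rn x hB) => y hB_y.
rewrite /E (fourier_kernelD z x y).
exact: mulrACA_comm (comm_fourier_kernel z y hB_y).
Qed.

Lemma right_fourier_convolution h k z : clifford_integrable h ->
  clifford_integrable k -> {ae m, forall x, bivector_algebra (k x)} ->
  right_fourier (convolution h k) z = right_fourier h z * right_fourier k z.
Proof.
move=> hi ki kB; pose E := fourier_kernel z.
have Ei F : clifford_integrable F -> clifford_integrable (fun x => F x * E x).
  exact: (clifford_integrable_multr (measurable_fourier_kernel z)
    (fun I x => fourier_kernel_bounded z x I)).
rewrite /right_fourier -(clifford_integral_convolution (Ei _ hi) (Ei _ ki)).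
apply: clifford_integral_ae.
apply: filterS (ae_clifford_integrable_convolution hi ki) => x hki.
apply: etrans (esym (clifford_integralMr (E x) hki)) _.
apply: clifford_integral_ae.
apply: filterS kB => y kB_y.
rewrite /E (fourier_kernelD z x y).
exact: mulrACA_comm (commr_sym (comm_fourier_kernel z (sub_Rn x y) kB_y)).
Qed.

End fourier_of_convolution.

Unset Implicit Arguments.

Theorem mainTheorem6 (R : realType) (n : nat) (f g : Rn R n -> G2n R n)
    (hf : L1 f) (hg : L1 g) :
  ((forall x, bivector_algebra (f x)) ->
     forall y, left_fourier (convolution f g) y =
               left_fourier f y * left_fourier g y) /\
  ((forall x, bivector_algebra (g x)) ->
     forall y, right_fourier (convolution f g) y =
               right_fourier f y * right_fourier g y).
Proof.
have [h fh hi] := L1_representative hf; have [k gk ki] := L1_representative hg.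
split=> [fB|gB] y; rewrite (convolution_ae fh gk).
  rewrite (left_fourier_ae _ fh) (left_fourier_ae _ gk).
  apply: left_fourier_convolution => //.
  by apply: filterS fh => x <-.
rewrite (right_fourier_ae _ fh) (right_fourier_ae _ gk).
apply: right_fourier_convolution => //.
by apply: filterS gk => x <-.
Qed.
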